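(* Let $\Omega\subset\mathbb{D}$ be an open set, bounded with respect to the hyperbolic metric $d_h$. Then $\mathcal{L}_h$ is a positive operator on $L^2(\Omega)$, i.e. $\langle\mathcal{L}_hf,f\rangle\ge 0$ for all $f\in L^2(\Omega)$.
   Context: $\mathbb{D}=\{z\in\mathbb{C}:|z|<1\}$ is the Poincaré disk; $[z,w]=\left|\frac{z-w}{1-\overline{z}w}\right|$ is the pseudo-hyperbolic distance; $d_h(z,w)=2\tanh^{-1}[z,w]$ is the hyperbolic distance. Let $d\mu(w)=\frac1\pi\frac{dA(w)}{(1-|w|^2)^2}$ with $dA$ the Lebesgue area measure; $L^2(\Omega)$ is the space of (real-valued) functions square integrable on $\Omega$ with respect to $\mu$, with inner product $\langle u,v\rangle=\int_\Omega uv\,d\mu$. The hyperbolic logarithmic potential operator $\mathcal{L}_h:L^2(\Omega)\to L^2(\Omega)$ is $\mathcal{L}_hu(z)=\frac12\int_\Omega\log\frac{1}{[z,w]}\,u(w)\,d\mu(w)$, $z\in\Omega$. *)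

(* Defs.v *)
From HB Require Import structures.
From mathcomp Require Import all_boot all_order all_algebra.
From mathcomp Require Import complex.
From mathcomp Require Import all_classical all_reals all_analysis.
From mathcomp Require Import measurable_realfun.

Set Implicit Arguments.
Unset Strict Implicit.
Unset Printing Implicit Defensive.

Import Order.TTheory GRing.Theory Num.Theory.
Import numFieldNormedType.Exports.

Local Open Scope classical_set_scope.
Local Open Scope ring_scope.

(* The complex plane is the topological and measurable space R * R, with
   product topology, Borel sigma-algebra and Lebesgue product measure;
   complex arithmetic is that of R[i], through toC. *)
Notation plane R := (measurableTypeR R * measurableTypeR R)%type.

Section HyperbolicDisk.
Context {R : realType}.
Implicit Types (z w : plane R) (Omega : set (plane R)) (f u v : plane R -> R).

Definition toC z : R[i] := Complex z.1 z.2.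

Definition cmod (c : R[i]) : R := ComplexField.Normc.normc c.

Definition disk : set (plane R) := [set z | cmod (toC z) < 1].

Definition pseudo_hyp_dist z w : R :=
  cmod ((toC z - toC w) / (1 - conjc (toC z) * toC w)).

Definition artanh (x : R) : R := 2^-1 * ln ((1 + x) / (1 - x)).

Definition hyp_dist z w : R := 2 * artanh (pseudo_hyp_dist z w).

Definition hyp_bounded Omega : Prop :=
  exists M : R, forall z w, Omega z -> Omega w -> hyp_dist z w <= M.

Definition area : {measure set (plane R) -> \bar R} :=
  (@lebesgue_measure R \x @lebesgue_measure R)%E.

(* Extended by 0 outside the disk, so that mu is a measure on the whole plane
   concentrated on the disk. *)
Definition mu_density : plane R -> R :=
  (fun w => pi^-1 / (1 - cmod (toC w) ^+ 2) ^+ 2) \_ disk.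

Definition hyp_measure (A : set (plane R)) : \bar R :=
  (\int[area]_(w in A) (mu_density w)%:E)%E.

Lemma cmod_sqr z : cmod (toC z) ^+ 2 = z.1 ^+ 2 + z.2 ^+ 2.
Proof. by rewrite /cmod /= sqr_sqrtr// addr_ge0// sqr_ge0. Qed.

Lemma diskE : disk = [set z | z.1 ^+ 2 + z.2 ^+ 2 < 1].
Proof.
apply/seteqP; split => z /=; rewrite -cmod_sqr.
  by move=> z1; rewrite expr_lt1// sqrtr_ge0.
by rewrite expr_lt1// sqrtr_ge0.
Qed.

Lemma measurable_normsq :
  measurable_fun [set: plane R] (fun z => z.1 ^+ 2 + z.2 ^+ 2 : R).
Proof.
apply: measurable_funD; apply: measurable_funX.
  exact: measurable_fst.
exact: measurable_snd.
Qed.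

Lemma measurable_disk : measurable disk.
Proof.
rewrite diskE -[X in measurable X]setTI.
have -> : [set z : plane R | z.1 ^+ 2 + z.2 ^+ 2 < 1] =
    (fun z => z.1 ^+ 2 + z.2 ^+ 2 : R) @^-1` `]-oo, 1[%classic.
  by apply/seteqP; split => z /=; rewrite in_itv.
exact: measurable_normsq.
Qed.

Lemma mu_density_ge0 w : 0 <= mu_density w.
Proof.
rewrite /mu_density patchE; case: ifP => // _.
by rewrite divr_ge0 ?invr_ge0 ?pi_ge0 ?sqr_ge0.
Qed.

Lemma measurable_mu_density : measurable_fun [set: plane R] mu_density.
Proof.
apply/(measurable_restrict _ measurable_disk) => //; rewrite setTI.
apply: (eq_measurable_fun
    (fun z : plane R => pi^-1 * ((1 - (z.1 ^+ 2 + z.2 ^+ 2)) `^ (-1)) ^+ 2)).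
  move=> z /set_mem; rewrite diskE /= => z1.
  by rewrite cmod_sqr powR_inv1 ?exprVn// subr_ge0 ltW.
apply: measurable_funTS; apply: measurable_funM => //.
apply: measurable_funX.
apply: (measurableT_comp (f := fun x : R => x `^ (-1))
  (g := fun z : plane R => 1 - (z.1 ^+ 2 + z.2 ^+ 2))).
  exact: measurable_powR.
by apply: measurable_funB => //; exact: measurable_normsq.
Qed.

Let hyp_measure0 : hyp_measure set0 = 0%E.
Proof. exact: integral_set0. Qed.

Let hyp_measure_ge0 A : (0 <= hyp_measure A)%E.
Proof. by apply: integral_ge0 => w _; rewrite lee_fin mu_density_ge0. Qed.

Let hyp_measure_semi_sigma_additive : semi_sigma_additive hyp_measure.
Proof.
apply: semi_sigma_additive_nng_induced => [|w].
  by apply/measurable_EFinP; exact: measurable_mu_density.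
by rewrite lee_fin mu_density_ge0.
Qed.

HB.instance Definition _ := isMeasure.Build _ _ _ hyp_measure
  hyp_measure0 hyp_measure_ge0 hyp_measure_semi_sigma_additive.

Definition mu : {measure set (plane R) -> \bar R} := hyp_measure.

(* Elements of L^2(Omega) are represented by Borel functions on Omega; the
   values of f outside Omega are irrelevant. *)
Definition L2 Omega f : Prop :=
  measurable_fun Omega f /\ mu.-integrable Omega (EFin \o (fun z => f z ^+ 2)).

Definition inner Omega u v : R := \int[mu]_(z in Omega) (u z * v z).

(* On the diagonal ln (0^-1) = 0 instead of +oo; for each z this concerns the
   single point w = z, which is mu-negligible. *)
Definition Lh Omega u z : R :=
  2^-1 * \int[mu]_(w in Omega) (ln (pseudo_hyp_dist z w)^-1 * u w).

(* The first conjunct makes T an operator on L^2(Omega). *)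
Definition positive_operator Omega (T : (plane R -> R) -> plane R -> R) : Prop :=
  forall f, L2 Omega f -> L2 Omega (T f) /\ 0 <= inner Omega (T f) f.

End HyperbolicDisk.

(* Main.v *)
(* The identity
     1 - [z, w]^2 = q(z, w) := (1 - |z|^2) (1 - |w|^2) / |1 - conj z w|^2
   gives, for z <> w,
     log (1 / [z, w]) = - (1/2) log (1 - q(z, w)) = (1/2) sum_(k >= 1) q(z, w)^k / k.
   Now 1 / |1 - conj z w|^2 is the limit of |sum_(n < N) (conj z w)^n|^2, a finite
   sum of kernels phi(z) phi(w) with phi a real polynomial, and such sums are
   closed under sums and products; so q, its powers and the partial sums of the
   logarithmic series are limits of positive kernels of finite rank.
   Applying dominated convergence in w and then in z makes positivity (and the
   measurability of the image of f) pass to the limit, so Fubini's theorem is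
   never needed.  The dominating function for the last limit is
   (log (1 / [z, w])^2 + f(w)^2) / 2, whose integral over w is bounded uniformly
   in z because the kernel is at most log (2 / |Re z - Re w|). *)
Require Import Defs.
From mathcomp Require Import all_boot all_order all_algebra.
From mathcomp Require Import complex.
From mathcomp Require Import all_classical all_reals all_analysis.
From mathcomp Require Import measurable_realfun ring lra.
Import Order.TTheory GRing.Theory Num.Theory.
Import numFieldNormedType.Exports.
Local Open Scope classical_set_scope.
Local Open Scope ring_scope.

Set Implicit Arguments.
Unset Strict Implicit.
Unset Printing Implicit Defensive.

(** * Positive kernels *)

(** Dominated convergence for real-valued integrals, together with the bound of the limit integral
    by that of the dominating function. Applied to a constant sequence, it yields just integrability
    and this bound. *)
Lemma Rintegral_dominated_cvg {d} {T : measurableType d} {R : realType}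
    {mu : {measure set T -> \bar R}} {D : set T}
    {u : nat -> T -> R} {v g : T -> R} :
  measurable D -> (forall n, measurable_fun D (u n)) -> measurable_fun D v ->
  {ae mu, forall x, D x -> u n x @[n --> \oo] --> v x} ->
  mu.-integrable D (EFin \o g) -> (forall x, D x -> 0 <= g x) ->
  {ae mu, forall x n, D x -> `|u n x| <= g x} ->
  [/\ mu.-integrable D (EFin \o v),
      `|\int[mu]_(x in D) v x| <= \int[mu]_(x in D) g x &
      \int[mu]_(x in D) u n x @[n --> \oo] --> \int[mu]_(x in D) v x].
Proof.
move=> mD mu_ mv uv ig g0 ug.
have mU n : measurable_fun D (EFin \o u n) by exact/measurable_EFinP.
have mV : measurable_fun D (EFin \o v) by exact/measurable_EFinP.
have UV : {ae mu, forall x, D x -> (EFin \o u n) x @[n --> \oo] --> (EFin \o v) x}.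
  apply: filterS uv => x uvx Dx.
  by apply: cvg_EFin; [exact: nearW | exact: uvx].
have UG : {ae mu, forall x n, D x -> (`|(EFin \o u n) x| <= (EFin \o g) x)%E}.
  by apply: filterS ug => x ugx n Dx; rewrite /= lee_fin; exact: ugx.
have [iv _ cv] := dominated_convergence mD mU mV UV ig UG.
have cvgv : \int[mu]_(x in D) u n x @[n --> \oo] --> \int[mu]_(x in D) v x.
  by apply: fine_cvg; rewrite fineK; [exact: cv | exact: integrable_fin_num].
split => //.
have iN : mu.-integrable D (EFin \o (fun x => `|v x|)).
  exact: integrable_norm.
rewrite (le_trans (le_normr_Rintegral mD iv))//.
rewrite /Rintegral fine_le ?integrable_fin_num//.
have h : {ae mu, forall x, D x -> `|v x| <= g x}.
  apply: filterS2 ug uv => x ugx uvx Dx.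
  apply: (ler_cvg_to (cvg_norm (uvx Dx)) (cvg_cst (g x))).
  by apply: nearW => n; exact: ugx.
apply: ae_ge0_le_integral => //.
- exact: measurable_int iN.
- exact: measurable_int ig.
Qed.

Section positive_kernel.
Context {d} {T : measurableType d} {R : realType}.
Variables (mu : {measure set T -> \bar R}) (D : set T) (f : T -> R).
Implicit Types (k h : T -> T -> R) (phi : T -> R).

Definition kernel_op k z : R := \int[mu]_(w in D) (k z w * f w).

(** Positivity is tested against the single fixed function [f]. Measurability of the image is part
    of the notion so that it passes to limits together with the sign. *)
Definition kernel_pos k : Prop :=
  measurable_fun D (kernel_op k) /\
  0 <= \int[mu]_(z in D) (kernel_op k z * f z).

(** Dominated convergence in w makes [kernel_op (u n)] converge pointwise on [D], with all values
    bounded by [B]. The outer integrands are then dominated by the integrable function [B * |f|],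
    and dominated convergence in z preserves the sign. *)
Lemma kernel_pos_lim {u : nat -> T -> T -> R} {k h} {B : R} :
  measurable D -> mu.-integrable D (EFin \o f) ->
  (forall n, kernel_pos (u n)) ->
  (forall n z, D z -> measurable_fun D (u n z)) ->
  (forall z, D z -> measurable_fun D (k z)) ->
  (forall z, D z ->
    {ae mu, forall w, D w -> u n z w @[n --> \oo] --> k z w}) ->
  (forall z, D z -> mu.-integrable D (EFin \o h z)) ->
  (forall z w, D z -> D w -> 0 <= h z w) ->
  (forall z, D z -> \int[mu]_(w in D) h z w <= B) ->
  (forall z, D z ->
    {ae mu, forall w n, D w -> `|u n z w * f w| <= h z w}) ->
  kernel_pos k /\ (forall z, D z -> `|kernel_op k z| <= B).
Proof.
move=> mD iF pu mu_ mk uk ih h0 hB uh.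
have mf : measurable_fun D f by apply/measurable_EFinP; exact: measurable_int iF.
have dom z : D z -> [/\ mu.-integrable D (EFin \o (fun w => k z w * f w)),
      `|kernel_op k z| <= \int[mu]_(x in D) h z x &
      kernel_op (u n) z @[n --> \oo] --> kernel_op k z].
  move=> Dz; apply: Rintegral_dominated_cvg => //.
  - by move=> n; apply: measurable_funM => //; exact: mu_.
  - by apply: measurable_funM => //; exact: mk.
  - apply: filterS (uk z Dz) => w ukw Dw.
    by apply: cvgM; [exact: ukw | exact: cvg_cst].
  - exact: ih.
  - by move=> w Dw; exact: h0.
  - exact: uh.
have kB z : D z -> `|kernel_op k z| <= B.
  by move=> Dz; have [_ + _] := dom z Dz; move=> /le_trans; apply; exact: hB.
have uB n z : D z -> `|kernel_op (u n) z| <= B.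
  move=> Dz.
  (* The constant sequence [u n z] is used here, only for the bound on its integral. *)
  have [] := @Rintegral_dominated_cvg _ _ _ mu D
    (fun _ w => u n z w * f w) (fun w => u n z w * f w) (h z).
  all: try by [].
  - by move=> _; apply: measurable_funM => //; exact: mu_.
  - by apply: measurable_funM => //; exact: mu_.
  - by apply: nearW => w _; exact: cvg_cst.
  - exact: ih.
  - by move=> w; exact: h0.
  - by apply: filterS (uh z Dz) => w H m; exact: H.
  - by move=> _ + _; move=> /le_trans; apply; exact: hB.
have mK : measurable_fun D (kernel_op k).
  apply: (@measurable_fun_cvg _ _ _ D (fun n => kernel_op (u n))).
    by move=> n; have [] := pu n.
  by move=> z Dz; have [] := dom z Dz.
split => //; split => //.
have [] := @Rintegral_dominated_cvg _ _ _ mu D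
    (fun n z => kernel_op (u n) z * f z) (fun z => kernel_op k z * f z)
    (fun z => B * `|f z|).
all: try by [].
- by move=> n; apply: measurable_funM => //; have [] := pu n.
- exact: measurable_funM.
- apply: nearW => z Dz; apply: cvgM; last exact: cvg_cst.
  by have [] := dom z Dz.
- rewrite (_ : _ \o _ = fun z => B%:E * (`|f z|)%:E)%E//.
  by apply: integrableZl => //; exact: integrable_norm.
- move=> z Dz; rewrite mulr_ge0//; exact: le_trans (kB z Dz).
- apply: nearW => z n Dz; rewrite normrM ler_wpM2r//; exact: uB.
- move=> _ _ /(ler_cvg_to (cvg_cst 0)); apply; apply: nearW => n.
  by have [] := pu n.
Qed.

(** Nonnegative combinations of rank-one kernels, with the factors taken from a class [good] left
    abstract so that closure under products can be assumed separately. *)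
Inductive finite_rank (good : (T -> R) -> Prop) : (T -> T -> R) -> Prop :=
| Finite_rank0 : finite_rank good (fun _ _ => 0)
| Finite_rankS phi k c : 0 <= c -> good phi -> finite_rank good k ->
    finite_rank good (fun z w => c * (phi z * phi w) + k z w).

(** The quadratic form is the sum of the [c * (\int phi f)^2]. Each rank-one term separates the two
    variables, so the iterated integral splits by linearity alone. *)
Lemma finite_rank_pos good k : measurable D -> mu.-integrable D (EFin \o f) ->
  (forall phi, good phi -> measurable_fun D phi /\ [bounded phi x | x in D]) ->
  finite_rank good k ->
  kernel_pos k.
Proof.
move=> mD iF goodP.
have iM phi : good phi -> mu.-integrable D (EFin \o (fun w => phi w * f w)).
  move=> /goodP[mphi bphi].
  rewrite (_ : EFin \o _ = ((EFin \o phi) \* (EFin \o f))%E).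
    exact: integrableMr.
  by apply/funext => x /=; rewrite EFinM.
(* The induction also carries the integrability of the inner and outer integrands, which linearity
   of the integral requires. *)
suff H : finite_rank good k ->
   [/\ forall z, mu.-integrable D (EFin \o (fun w => k z w * f w)),
     kernel_pos k &
     mu.-integrable D (EFin \o (fun z => kernel_op k z * f z))].
  by move=> /H[].
elim=> [|phi {}k c c0 gphi _ [ik [mk pk] ikk]].
  have i0 : mu.-integrable D (EFin \o (fun=> 0 : R)) by exact: integrable0.
  have o0 : kernel_op (fun _ _ => 0) = fun=> 0.
    apply/funext => z; rewrite /kernel_op.
    by under eq_Rintegral do rewrite mul0r; rewrite /Rintegral integral0.
  split => [z||].
  - by under eq_fun do rewrite mul0r.
  - rewrite /kernel_pos o0; split => //.
    by under eq_Rintegral do rewrite mul0r; rewrite /Rintegral integral0.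
  - by rewrite o0; under eq_fun do rewrite mul0r.
pose I := \int[mu]_(w in D) (phi w * f w).
have iphi z : mu.-integrable D (EFin \o (fun w => c * phi z * (phi w * f w))).
  rewrite (_ : _ \o _ = fun w => (c * phi z)%:E * (phi w * f w)%:E)%E//.
  by apply: integrableZl => //; exact: iM.
have opE z : kernel_op (fun z w => c * (phi z * phi w) + k z w) z =
    c * phi z * I + kernel_op k z.
  rewrite /kernel_op -RintegralZl//; last exact: iM.
  rewrite -RintegralD//.
  by apply: eq_Rintegral => w _; rewrite mulrDl !mulrA.
have iphi' : mu.-integrable D (EFin \o (fun z => c * I * (phi z * f z))).
  rewrite (_ : _ \o _ = fun w => (c * I)%:E * (phi w * f w)%:E)%E//.
  by apply: integrableZl => //; exact: iM.
have op2E : (fun z => kernel_op (fun z w => c * (phi z * phi w) + k z w) z * f z)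
  = (fun z => c * I * (phi z * f z) + kernel_op k z * f z).
  by apply/funext => z; rewrite opE mulrDl -!mulrA (mulrCA (phi z)) (mulrC I).
split.
- move=> z.
  rewrite (_ : _ \o _ = (EFin \o (fun w => c * phi z * (phi w * f w))%R)
    \+ (EFin \o (fun w => k z w * f w)%R))%E; first exact: integrableD.
  by apply/funext => w /=; rewrite mulrDl !mulrA.
- split.
    apply: (eq_measurable_fun (fun z => c * phi z * I + kernel_op k z)).
      by move=> z _; rewrite opE.
    apply: measurable_funD => //; apply: measurable_funM => //.
    apply: measurable_funM => //.
    by have [] := goodP _ gphi.
  rewrite op2E RintegralD// RintegralZl//; last exact: iM.
  by rewrite addr_ge0// -mulrA mulr_ge0// -expr2 sqr_ge0.
- rewrite op2E.
  rewrite (_ : _ \o _ = (EFin \o (fun z => c * I * (phi z * f z))%R)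
    \+ (EFin \o (fun z => kernel_op k z * f z)%R))%E//; exact: integrableD.
Qed.

End positive_kernel.

Lemma finite_rank_measurable {d} {T : measurableType d} {R : realType}
    (good : (T -> R) -> Prop) (D : set T) (k : T -> T -> R) (z : T) :
  (forall phi, good phi -> measurable_fun D phi) ->
  finite_rank good k -> measurable_fun D (k z).
Proof.
move=> goodP; elim=> [|phi {}k c c0 gphi _ IH]; first exact: measurable_cst.
apply: measurable_funD => //; do 2 apply: measurable_funM => //.
exact: goodP.
Qed.

(** * Closure of finite-rank kernels under sums, products and powers *)

Section finite_rank_closure.
Context {d} {T : measurableType d} {R : realType}.
Variable good : (T -> R) -> Prop.
Hypothesis goodM : forall phi psi, good phi -> good psi -> good (fun z => phi z * psi z).
Implicit Types k : T -> T -> R.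

Lemma finite_rankD k1 k2 : finite_rank good k1 -> finite_rank good k2 ->
  finite_rank good (fun z w => k1 z w + k2 z w).
Proof.
move=> fk1 fk2; elim: fk1 => [|phi k c c0 gphi _ IH].
  by rewrite (_ : (fun _ => _) = k2)//; apply/funext => z; apply/funext => w; rewrite add0r.
rewrite (_ : (fun _ => _) = fun z w => c * (phi z * phi w) + (k z w + k2 z w)).
  exact: Finite_rankS.
by apply/funext => z; apply/funext => w; rewrite addrA.
Qed.

Lemma finite_rank1 phi : good phi -> finite_rank good (fun z w => phi z * phi w).
Proof.
move=> gphi.
rewrite (_ : (fun _ => _) = fun z w => 1 * (phi z * phi w) + 0).
  by apply: Finite_rankS => //; exact: Finite_rank0.
by apply/funext => z; apply/funext => w; rewrite mul1r addr0.
Qed.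

Lemma finite_rank_sum n (k : nat -> T -> T -> R) :
  (forall i, finite_rank good (k i)) ->
  finite_rank good (fun z w => \sum_(i < n) k i z w).
Proof.
move=> fk; elim: n => [|n IH].
  rewrite (_ : (fun _ => _) = fun _ _ => 0); first exact: Finite_rank0.
  by apply/funext => z; apply/funext => w; rewrite big_ord0.
rewrite (_ : (fun _ => _) = fun z w => \sum_(i < n) k i z w + k n z w).
  exact: finite_rankD.
by apply/funext => z; apply/funext => w; rewrite big_ord_recr.
Qed.

Lemma finite_rankZ a k : 0 <= a -> finite_rank good k ->
  finite_rank good (fun z w => a * k z w).
Proof.
move=> a0; elim=> [|phi {}k c c0 gphi _ IH].
  rewrite (_ : (fun _ => _) = fun _ _ => 0); first exact: Finite_rank0.
  by apply/funext => z; apply/funext => w; rewrite mulr0.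
rewrite (_ : (fun _ => _) = fun z w => (a * c) * (phi z * phi w) + a * k z w).
  by apply: Finite_rankS => //; exact: mulr_ge0.
by apply/funext => z; apply/funext => w; rewrite mulrDr mulrA.
Qed.

(** The finite-rank case of the Schur product theorem: the product of the rank-one kernels of [phi]
    and [psi] is the rank-one kernel of [phi * psi]. One induction runs over each factor. *)
Lemma finite_rankM k1 k2 : finite_rank good k1 -> finite_rank good k2 ->
  finite_rank good (fun z w => k1 z w * k2 z w).
Proof.
move=> + fk2; elim=> [|phi k c c0 gphi _ IH].
  rewrite (_ : (fun _ => _) = fun _ _ => 0); first exact: Finite_rank0.
  by apply/funext => z; apply/funext => w; rewrite mul0r.
rewrite (_ : (fun _ => _) =
    fun z w => c * (phi z * phi w * k2 z w) + k z w * k2 z w); last first.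
  by apply/funext => z; apply/funext => w; ring.
apply: finite_rankD => //; apply: finite_rankZ => //.
elim: fk2 => [|psi k' b b0 gpsi _ IH'].
  rewrite (_ : (fun _ => _) = fun _ _ => 0); first exact: Finite_rank0.
  by apply/funext => z; apply/funext => w; rewrite mulr0.
rewrite (_ : (fun _ => _) = fun z w =>
    b * ((phi z * psi z) * (phi w * psi w)) + phi z * phi w * k' z w).
  by apply: Finite_rankS => //; exact: goodM.
by apply/funext => z; apply/funext => w; ring.
Qed.

Lemma finite_rankX k n : good (fun=> 1) -> finite_rank good k ->
  finite_rank good (fun z w => k z w ^+ n).
Proof.
move=> g1 fk; elim: n => [|n IH].
  rewrite (_ : (fun _ => _) = fun _ _ => 1 * 1); first exact: (@finite_rank1 (fun=> 1)).
  by apply/funext => z; apply/funext => w; rewrite expr0 mulr1.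
rewrite (_ : (fun _ => _) = fun z w => k z w * k z w ^+ n); first exact: finite_rankM.
by apply/funext => z; apply/funext => w; rewrite exprS.
Qed.

End finite_rank_closure.

(** * Finite-rank approximation of 1 / |1 - conj z w|^2 *)

Section disk_bounded.
Context {R : realType}.
Implicit Types (z w : plane R) (phi psi : plane R -> R) (F G : plane R -> R[i]).

(** The bound is asked on the disk only, so that real polynomials in the coordinates qualify. *)
Definition disk_bounded phi : Prop :=
  measurable_fun [set: plane R] phi /\
  exists M : R, forall z, disk z -> `|phi z| <= M.

Lemma disk_boundedD phi psi : disk_bounded phi -> disk_bounded psi ->
  disk_bounded (fun z => phi z + psi z).
Proof.
move=> [mphi [M HM]] [mpsi [N HN]]; split; first exact: measurable_funD.
exists (M + N) => z zD; rewrite (le_trans (ler_normD _ _))// lerD//.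
  exact: HM.
exact: HN.
Qed.

Lemma disk_boundedM phi psi : disk_bounded phi -> disk_bounded psi ->
  disk_bounded (fun z => phi z * psi z).
Proof.
move=> [mphi [M HM]] [mpsi [N HN]]; split; first exact: measurable_funM.
exists (M * N) => z zD; rewrite normrM ler_pM//; [exact: HM | exact: HN].
Qed.

Lemma disk_bounded_cst (c : R) : disk_bounded (fun=> c).
Proof. by split => //; exists `|c|. Qed.

Lemma disk_boundedN phi : disk_bounded phi -> disk_bounded (fun z => - phi z).
Proof.
move=> dphi; rewrite (_ : (fun _ => _) = fun z => -1 * phi z).
  by apply: disk_boundedM => //; exact: disk_bounded_cst.
by apply/funext => z; rewrite mulN1r.
Qed.

Lemma disk_bounded_fst : disk_bounded (fun z => z.1).
Proof.
split; first exact: measurable_fst.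
exists 1 => z; rewrite diskE /= => zD.
by rewrite -(@ler_pXn2r _ 2)// ?nnegrE// expr1n real_normK ?num_real//; nra.
Qed.

Lemma disk_bounded_snd : disk_bounded (fun z => z.2).
Proof.
split; first exact: measurable_snd.
exists 1 => z; rewrite diskE /= => zD.
by rewrite -(@ler_pXn2r _ 2)// ?nnegrE// expr1n real_normK ?num_real//; nra.
Qed.

Definition disk_boundedC F : Prop :=
  disk_bounded (fun z => complex.Re (F z)) /\
  disk_bounded (fun z => complex.Im (F z)).

Lemma disk_boundedCM F G : disk_boundedC F -> disk_boundedC G ->
  disk_boundedC (fun z => F z * G z).
Proof.
move=> [F1 F2] [G1 G2]; split.
  rewrite (_ : (fun _ => _) = fun z => complex.Re (F z) * complex.Re (G z)
     + - (complex.Im (F z) * complex.Im (G z))).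
    by apply: disk_boundedD; [|apply: disk_boundedN]; exact: disk_boundedM.
  by apply/funext => z; case: (F z) (G z) => [a b] [c e].
rewrite (_ : (fun _ => _) = fun z => complex.Re (F z) * complex.Im (G z)
     + complex.Im (F z) * complex.Re (G z)).
  by apply: disk_boundedD; exact: disk_boundedM.
by apply/funext => z; case: (F z) (G z) => [a b] [c e].
Qed.

Lemma disk_boundedCX F n : disk_boundedC F -> disk_boundedC (fun z => F z ^+ n).
Proof.
move=> dF; elim: n => [|n IH].
  by split; exact: disk_bounded_cst.
rewrite (_ : (fun _ => _) = fun z => F z * F z ^+ n); first exact: disk_boundedCM.
by apply/funext => z; rewrite exprS.
Qed.

Definition normsq (c : R[i]) : R := complex.Re c ^+ 2 + complex.Im c ^+ 2.

Lemma normsqM (a b : R[i]) : normsq (a * b) = normsq a * normsq b.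
Proof. by case: a b => [a b] [c e]; rewrite /normsq /=; ring. Qed.

Lemma normsqX (a : R[i]) n : normsq (a ^+ n) = normsq a ^+ n.
Proof.
elim: n => [|n IH]; last by rewrite !exprS normsqM IH.
by rewrite /normsq !expr0 /= expr1n expr0n /= addr0.
Qed.

Lemma normsq_conj (a : R[i]) : normsq (conjc a) = normsq a.
Proof. by case: a => a b; rewrite /normsq /= sqrrN. Qed.

(** Real parts are taken termwise so that each summand is a real kernel, which then splits as a
    product of real parts plus a product of imaginary parts. *)
Lemma normsq_sum n (a : nat -> R[i]) : normsq (\sum_(i < n) a i) =
  \sum_(i < n) \sum_(j < n) complex.Re (a i * conjc (a j)).
Proof.
have E (c : R[i]) : normsq c = complex.Re (c * conjc c).
  by case: c => x y; rewrite /normsq /=; ring.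
rewrite E rmorph_sum mulr_suml raddf_sum /=; apply: eq_bigr => i _.
by rewrite mulr_sumr raddf_sum.
Qed.

Definition geom_kernel N z w : R :=
  normsq (\sum_(n < N) (conjc (toC z) * toC w) ^+ n).

(* |sum_n (conj z w)^n|^2 = sum_(m, n) conj (phi z) * phi w with
   phi z = z^m (conj z)^n. *)
Lemma finite_rank_geom N : finite_rank disk_bounded (geom_kernel N).
Proof.
pose phi m n z := toC z ^+ m * conjc (toC z) ^+ n : R[i].
have -> : geom_kernel N = fun z w => \sum_(m < N) \sum_(n < N)
    (complex.Re (phi m n z) * complex.Re (phi m n w) +
     complex.Im (phi m n z) * complex.Im (phi m n w)).
  apply/funext => z; apply/funext => w; rewrite /geom_kernel.
  rewrite (normsq_sum N (fun n => (conjc (toC z) * toC w) ^+ n)).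
  apply: eq_bigr => m _; apply: eq_bigr => n _.
  have -> : (conjc (toC z) * toC w) ^+ m * conjc ((conjc (toC z) * toC w) ^+ n)
      = conjc (phi m n z) * phi m n w.
    have cM (x y : R[i]) : conjc (x * y) = conjc x * conjc y by exact: rmorphM.
    have cX (x : R[i]) k : conjc (x ^+ k) = conjc x ^+ k by exact: rmorphXn.
    by rewrite /phi !(cM, cX) conjcK !exprMn; ring.
  by case: (phi m n z) (phi m n w) => [a b] [c e] /=; ring.
apply: (@finite_rank_sum _ _ _ _ N (fun m z w => \sum_(n < N)
    (complex.Re (phi m n z) * complex.Re (phi m n w) +
     complex.Im (phi m n z) * complex.Im (phi m n w)))) => m.
apply: (@finite_rank_sum _ _ _ _ N (fun n z w =>
    (complex.Re (phi m n z) * complex.Re (phi m n w) +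
     complex.Im (phi m n z) * complex.Im (phi m n w)))) => n.
have [pR pI] : disk_boundedC (phi m n).
  apply: disk_boundedCM; apply: disk_boundedCX; split => /=.
  - exact: disk_bounded_fst.
  - exact: disk_bounded_snd.
  - exact: disk_bounded_fst.
  - by apply: disk_boundedN; exact: disk_bounded_snd.
by apply: finite_rankD; exact: finite_rank1.
Qed.

Definition sqn z : R := z.1 ^+ 2 + z.2 ^+ 2.

(* |1 - conj z w|^2; see normsq_1subM. *)
Definition den z w : R :=
  (1 - (z.1 * w.1 + z.2 * w.2)) ^+ 2 + (z.1 * w.2 - z.2 * w.1) ^+ 2.

Lemma disk_sqn z : disk z -> 0 <= sqn z < 1.
Proof. by rewrite diskE /sqn /= => ->; rewrite addr_ge0 ?sqr_ge0. Qed.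

(** This identity gives both the positivity of [den] on the disk and, after division by [den], the
    formula for 1 - [z, w]^2. *)
Lemma den_sqn z w : den z w =
  (z.1 - w.1) ^+ 2 + (z.2 - w.2) ^+ 2 + (1 - sqn z) * (1 - sqn w).
Proof. by rewrite /den /sqn; ring. Qed.

Lemma den_gt0 z w : disk z -> disk w -> 0 < den z w.
Proof.
move=> /disk_sqn/andP[_ z1] /disk_sqn/andP[_ w1]; rewrite den_sqn.
by rewrite ltr_wpDl ?addr_ge0 ?sqr_ge0// mulr_gt0// subr_gt0.
Qed.

Lemma normsq_1subM z w : normsq (1 - conjc (toC z) * toC w) = den z w.
Proof. by rewrite /normsq /den /=; ring. Qed.

(** With c = conj z w, the geometric sum times 1 - c telescopes to 1 - c^N, whose squared modulus is
    expanded. *)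
Lemma geom_kernelE N z w : geom_kernel N z w * den z w =
  1 - 2 * complex.Re ((conjc (toC z) * toC w) ^+ N) + (sqn z * sqn w) ^+ N.
Proof.
rewrite -normsq_1subM /geom_kernel.
set c := conjc (toC z) * toC w.
have -> : sqn z * sqn w = normsq c by rewrite normsqM normsq_conj.
rewrite mulrC -normsqM.
have -> : (1 - c) * \sum_(i < N) c ^+ i = 1 - c ^+ N.
  by rewrite -opprB mulNr -subrX1 opprB.
rewrite -normsqX; case: (c ^+ N) => a b.
by rewrite /normsq /=; ring.
Qed.

Lemma Re_exp_le (c : R[i]) n :
  `|complex.Re (c ^+ n)| <= Num.sqrt (normsq c) ^+ n.
Proof.
have c0 : 0 <= normsq c by rewrite /normsq addr_ge0// sqr_ge0.
rewrite -(@ler_pXn2r _ 2)// ?nnegrE// ?exprn_ge0 ?sqrtr_ge0//.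
rewrite real_normK ?num_real// exprAC sqr_sqrtr// -normsqX /normsq.
by rewrite lerDl sqr_ge0.
Qed.

Lemma geom_kernel_cvg z w : disk z -> disk w ->
  geom_kernel N z w @[N --> \oo] --> (den z w)^-1.
Proof.
move=> zD wD; have D0 := den_gt0 zD wD.
have /andP[z0 z1] := disk_sqn zD; have /andP[w0 w1] := disk_sqn wD.
have s0 : 0 <= sqn z * sqn w by exact: mulr_ge0.
have s1 : sqn z * sqn w < 1 by exact: mulr_ilt1.
set c := conjc (toC z) * toC w.
have cE : normsq c = sqn z * sqn w by rewrite normsqM normsq_conj.
have -> : (fun N => geom_kernel N z w) = fun N =>
   (1 - 2 * complex.Re (c ^+ N) + (sqn z * sqn w) ^+ N) * (den z w)^-1.
  by apply/funext => N; rewrite -geom_kernelE mulfK ?gt_eqF.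
rewrite -[X in _ --> X]mul1r; apply: cvgMl.
rewrite -[X in _ --> X]addr0; apply: cvgD; last first.
  by apply: cvg_expr; rewrite ger0_norm.
rewrite -[X in _ --> X]subr0 -[X in _ --> _ - X](mulr0 2).
apply: cvgB; first exact: cvg_cst.
apply: cvgMr.
have : Num.sqrt (normsq c) ^+ N @[N --> \oo] --> 0.
  by apply: cvg_expr; rewrite ger0_norm ?sqrtr_ge0// cE -sqrtr1 ltr_sqrt.
move=> h; apply/norm_cvg0P.
apply: (squeeze_cvgr _ (cvg_cst 0) h).
by apply: nearW => N; rewrite Re_exp_le normr_ge0.
Qed.

(** As |c| < 1, the three terms of [geom_kernelE] are at most 1, 2 and 1, whence the constant 4. *)
Lemma geom_kernel_le N z w : disk z -> disk w ->
  0 <= geom_kernel N z w <= 4 / den z w.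
Proof.
move=> zD wD; have D0 := den_gt0 zD wD.
have /andP[z0 z1] := disk_sqn zD; have /andP[w0 w1] := disk_sqn wD.
have s0 : 0 <= sqn z * sqn w by exact: mulr_ge0.
have s1 : sqn z * sqn w < 1 by exact: mulr_ilt1.
rewrite {1}/geom_kernel addr_ge0 ?sqr_ge0//= ler_pdivlMr// geom_kernelE.
set c := conjc (toC z) * toC w.
have cE : normsq c = sqn z * sqn w by rewrite normsqM normsq_conj.
have := Re_exp_le c N; rewrite ler_norml => /andP[h _].
have h1 : Num.sqrt (normsq c) ^+ N <= 1.
  by rewrite exprn_ile1// ?sqrtr_ge0// cE -sqrtr1 ler_sqrt// ltW.
have h2 : (sqn z * sqn w) ^+ N <= 1 by rewrite exprn_ile1// ltW.
lra.
Qed.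

End disk_bounded.

(** * The logarithmic kernel *)

Section log_series.
Context {R : realType}.
Implicit Types x t : R.

Definition log_sum M x : R := \sum_(k < M) x ^+ k.+1 / k.+1%:R.

Lemma is_derive_log_sum M x :
  is_derive x 1 (log_sum M) (\sum_(k < M) x ^+ k).
Proof.
elim: M => [|M IH].
  rewrite (_ : log_sum 0 = cst 0) ?big_ord0; first exact: is_derive_cst.
  by apply/funext => t; rewrite /log_sum big_ord0.
rewrite (_ : log_sum M.+1 = log_sum M \+ (M.+1%:R^-1 \*: (id ^+ M.+1))).
  rewrite big_ord_recr /=; apply: is_deriveD.
  have h : is_derive x 1 (M.+1%:R^-1 \*: (@id R ^+ M.+1))
      (M.+1%:R^-1 *: ((M.+1%:R * x ^+ M) *: 1)).
    by apply: is_deriveZ; exact: (@is_deriveX _ _ id M.+1).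
  rewrite -[X in is_derive _ _ _ X](_ : M.+1%:R^-1 *: ((M.+1%:R * x ^+ M) *: 1) = _)//.
  by rewrite scaler1 scalerA mulVf ?pnatr_eq0// scale1r.
apply/funext => t; rewrite /log_sum big_ord_recr /=; congr (_ + _).
by rewrite -[RHS]/(M.+1%:R^-1 * (@id R ^+ M.+1) t) exprfctE mulrC.
Qed.

(** The remainder vanishes at 0 and has derivative t^M / (1 - t). By the mean value theorem it
    equals x c^M / (1 - c) for some c in [0, x], and x <= 1. *)
Lemma log_sum_bounds M x : 0 <= x < 1 ->
  0 <= - ln (1 - x) - log_sum M x <= x ^+ M / (1 - x).
Proof.
move=> /andP[x0 x1].
pose F := (- (@ln R \o (fun t => 1 - t))) - log_sum M.
have dF t : t < 1 -> is_derive t 1 F (t ^+ M / (1 - t)).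
  move=> t1; have t1' : 0 < 1 - t by rewrite subr_gt0.
  have h1 : is_derive (1 - t) 1 (@ln R) (1 - t)^-1 by exact: is_derive1_ln.
  have h2 : is_derive t 1 (fun t => 1 - t) (-1 : R).
    have := is_deriveB (is_derive_cst (1 : R) t 1) (is_derive_id t 1).
    by rewrite sub0r.
  have h3 := @is_derive1_comp _ (@ln R) (fun t => 1 - t) t _ _ h1 h2.
  have h4 := is_derive_log_sum M t.
  have h5 : is_derive t 1 F (- ((1 - t)^-1 * -1) - (\sum_(k < M) t ^+ k)).
    exact: is_deriveB.
  apply: is_derive_eq.
  rewrite mulrN opprK mulr1.
  apply: (mulIf (lt0r_neq0 t1')); rewrite mulrBl mulVf ?gt_eqF// divfK ?gt_eqF//.
  have -> : t ^+ M = 1 + (t - 1) * \sum_(k < M) t ^+ k by rewrite -subrX1 addrC subrK.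
  by ring.
have cF : {within `[0, x], continuous F}.
  apply: derivable_within_continuous => t; rewrite in_itv /= => /andP[_ tx].
  by have [] := dF t (le_lt_trans tx x1).
have [t /[!in_itv]/=/andP[t0 t1]|c /[!in_itv]/=/andP[c0 cx]] :=
    @MVT_segment _ F (fun t => t ^+ M / (1 - t)) 0 x x0 _ cF.
  exact/dF/(lt_trans t1).
rewrite /F /= subr0 !fctE /= subr0 ln1 oppr0.
have -> : log_sum M 0 = 0.
  by rewrite /log_sum big1// => k _; rewrite expr0n mul0r.
rewrite !subr0 => ->.
have c1 : c < 1 := le_lt_trans cx x1.
rewrite mulr_ge0//= ?divr_ge0 ?exprn_ge0 ?subr_ge0 ?(ltW c1)//.
rewrite -[leRHS]mulr1 ler_pM ?divr_ge0 ?exprn_ge0 ?subr_ge0 ?(ltW c1) ?(ltW x1)//.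
rewrite ler_pM ?exprn_ge0 ?invr_ge0 ?subr_ge0 ?(ltW c1)//.
  by rewrite lerXn2r ?nnegrE.
by rewrite lef_pV2 ?posrE ?subr_gt0// lerB.
Qed.

Lemma log_sum_cvg x : 0 <= x < 1 ->
  log_sum M x @[M --> \oo] --> - ln (1 - x).
Proof.
move=> /[dup] x01 /andP[x0 x1]; apply/cvgrPdist_le => /= e e0.
have : x ^+ M / (1 - x) @[M --> \oo] --> 0.
  rewrite -[X in _ --> X](mul0r (1 - x)^-1); apply: cvgMl.
  by apply: cvg_expr; rewrite ger0_norm.
move/cvgrPdist_le => /(_ e e0) [N _ HN]; exists N => // M /HN.
have /andP[l0 lM] := log_sum_bounds M x01.
rewrite sub0r normrN (ger0_norm l0) => h; apply: (le_trans lM).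
by apply: le_trans h; exact: ler_norm.
Qed.

End log_series.

(** * The kernel log (1 / [z, w]) as a function of q *)

Section green_kernel.
Context {R : realType}.
Implicit Types (z w : plane R).

Lemma cmod_normsq (c : R[i]) : cmod c = Num.sqrt (normsq c).
Proof. by case: c. Qed.

Definition dist2 z w : R := (z.1 - w.1) ^+ 2 + (z.2 - w.2) ^+ 2.

Lemma pseudo_hyp_distE z w : disk z -> disk w ->
  pseudo_hyp_dist z w = Num.sqrt (dist2 z w / den z w).
Proof.
move=> zD wD; have D0 := den_gt0 zD wD.
rewrite /pseudo_hyp_dist cmod_normsq; congr Num.sqrt.
set b := 1 - _.
have b0 : normsq b != 0 by rewrite normsq_1subM gt_eqF.
have bn : b != 0.
  by apply: contra_neq b0 => ->; rewrite /normsq /= expr0n /= addr0.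
rewrite -normsq_1subM -/b; apply: (mulIf b0).
by rewrite -normsqM divfK// divfK.
Qed.

(** The quantity q(z, w), that is |S(z, w)|^2 / (S(z, z) S(w, w)) for the Szego kernel S(z, w) = 1 /
    (1 - conj z w). *)
Definition szego_ratio z w : R := (1 - sqn z) * (1 - sqn w) / den z w.

Lemma szego_ratio_gt0 z w : disk z -> disk w -> 0 < szego_ratio z w.
Proof.
move=> zD wD; have D0 := den_gt0 zD wD.
have /andP[z0 z1] := disk_sqn zD; have /andP[w0 w1] := disk_sqn wD.
by rewrite divr_gt0// mulr_gt0// subr_gt0.
Qed.

Lemma szego_ratioE z w : disk z -> disk w ->
  dist2 z w / den z w = 1 - szego_ratio z w.
Proof.
move=> zD wD; have D0 := den_gt0 zD wD.
apply: (mulIf (lt0r_neq0 D0)); rewrite mulrBl !divfK ?gt_eqF// den_sqn /dist2.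
by ring.
Qed.

Lemma dist2_gt0 z w : z <> w -> 0 < dist2 z w.
Proof.
move=> zw; rewrite lt0r addr_ge0 ?sqr_ge0// andbT paddr_eq0 ?sqr_ge0//.
rewrite !sqrf_eq0 !subr_eq0; apply/negP => /andP[/eqP h1 /eqP h2].
by apply: zw; rewrite [z]surjective_pairing [w]surjective_pairing h1 h2.
Qed.

Lemma ln_pseudo_hyp_distE z w : disk z -> disk w -> z <> w ->
  ln (pseudo_hyp_dist z w)^-1 = 2^-1 * - ln (1 - szego_ratio z w).
Proof.
move=> zD wD zw; have D0 := den_gt0 zD wD.
have d0 : 0 < dist2 z w / den z w by rewrite divr_gt0// dist2_gt0.
rewrite pseudo_hyp_distE// -szego_ratioE//.
set x := dist2 z w / den z w in d0 *.
have s0 : 0 < Num.sqrt x by rewrite sqrtr_gt0.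
have -> : ln x = 2 * ln (Num.sqrt x).
  by rewrite -[in LHS](sqr_sqrtr (ltW d0)) lnXn// mulr_natl.
by rewrite lnV ?posrE// mulrN mulKf ?pnatr_eq0.
Qed.

End green_kernel.

(** * Uniform square integrability of the kernel *)

Section hyperbolic_measure.
Context {R : realType}.
Implicit Types (z w : plane R) (Omega : set (plane R)).

(** The sigma-algebra is a product of Borel algebras, whereas openness refers to the product
    topology; an open set is a countable union of boxes with rational centres. *)
Lemma open_measurable_plane Omega : open Omega -> measurable Omega.
Proof.
move=> oO.
pose box (p q : rat) n : set (plane R) :=
  `]ratr p - n.+1%:R^-1, ratr p + n.+1%:R^-1[%classic `*`
  `]ratr q - n.+1%:R^-1, ratr q + n.+1%:R^-1[%classic.
pose B (p q : rat) n := if `[< box p q n `<=` Omega >] then box p q n else set0.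
have -> : Omega = \bigcup_p \bigcup_q \bigcup_n B p q n.
  apply/seteqP; split => [z Oz|z [p _ [q _ [n _]]]]; last first.
    by rewrite /B; case: asboolP => // /[apply].
  have [[P Q] /= [/nbhs_ballP[e1 /= e10 P1] /nbhs_ballP[e2 /= e20 Q2]] PQO] :
      nbhs z Omega by exact: open_nbhs_nbhs.
  (* The factor 2 accounts for two errors of at most 1 / (n + 1): from z to the rational centre, and
     from the centre to a point of the box. *)
  have [n [n1 n2]] : exists n : nat, 2 * n.+1%:R^-1 < e1 /\ 2 * n.+1%:R^-1 < e2.
    have e0 : 0 < Num.min e1 e2 / 2 by rewrite divr_gt0// lt_min e10.
    have [N _ /(_ N (leqnn N)) HN] := near_infty_natSinv_lt (PosNum e0).
    exists N; move: HN => /=; rewrite ltr_pdivlMr// mulrC lt_min.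
    by move=> /andP[].
  have n0 : 0 < n.+1%:R^-1 :> R by rewrite invr_gt0.
  have approx (x : R) : exists p : rat, ratr p \in `]x - n.+1%:R^-1, x + n.+1%:R^-1[.
    have [|p pI] := @rat_in_itvoo R (x - n.+1%:R^-1) (x + n.+1%:R^-1).
      by move: n0; set i := n.+1%:R^-1 => n0; lra.
    by exists p.
  have [p] := approx z.1; have [q] := approx z.2.
  rewrite !in_itv /= => /andP[q1 q2] /andP[p1 p2].
  exists p => //; exists q => //; exists n => //; rewrite /B asboolT.
    by rewrite /box; split; rewrite /= in_itv /=; apply/andP; split;
      move: p1 p2 q1 q2; set i := n.+1%:R^-1 => *; lra.
  move=> w [] /=; rewrite !in_itv /= => /andP[w1 w2] /andP[w3 w4].
  apply: PQO; split; [apply: P1 | apply: Q2];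
    rewrite /ball /= ltr_norml; apply/andP; split;
    move: w1 w2 w3 w4 p1 p2 q1 q2 n1 n2; set i := n.+1%:R^-1 => *; lra.
have mB p q n : measurable (B p q n).
  rewrite /B; case: asboolP => _ //; apply: measurableX; exact: measurable_itv.
apply: bigcupT_measurable_rat => p.
apply: bigcupT_measurable_rat => q.
exact: bigcupT_measurable.
Qed.

Lemma hyp_measure_le (A : set (plane R)) (c : R) : measurable A -> 0 <= c ->
  (forall w, A w -> mu_density w <= c) -> (mu A <= c%:E * area A)%E.
Proof.
move=> mA c0 Ac; rewrite -integral_cst//.
apply: ge0_le_integral => //.
- by move=> w _; rewrite lee_fin mu_density_ge0.
- apply/measurable_EFinP; apply: measurable_funTS; exact: measurable_mu_density.
Qed.

Lemma areaX (A B : set R) : measurable A -> measurable B ->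
  area (A `*` B) = (lebesgue_measure A * lebesgue_measure B)%E.
Proof. by move=> mA mB; exact: product_measure1E. Qed.

Lemma vertical_lineE (a : R) :
  [set w : plane R | w.1 = a] = [set a] `*` setT.
Proof. by apply/seteqP; split => w /=; [split|case]. Qed.

Lemma measurable_vertical_line (a : R) : measurable [set w : plane R | w.1 = a].
Proof. by rewrite vertical_lineE; exact: measurableX. Qed.

Lemma measurable_strip (x e : R) :
  measurable [set w : plane R | `|x - w.1| <= e].
Proof.
rewrite (_ : [set w | _] = `[x - e, x + e]%classic `*` setT).
  by apply: measurableX => //; exact: measurable_itv.
by apply/seteqP; split => w /=; rewrite in_itv /= ler_distlC => // -[].
Qed.

Lemma mu_vertical_line (a : R) : mu [set w : plane R | w.1 = a] = 0%E.
Proof.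
rewrite vertical_lineE.
have mL : measurable ([set a] `*` setT : set (plane R)) by exact: measurableX.
have a0 : area ([set a] `*` setT : set (plane R)) = 0%E.
  by rewrite areaX// lebesgue_measure_set1 mul0e.
apply: (@null_set_integral _ _ R area) => //.
by apply/measurable_EFinP; apply: measurable_funTS; exact: measurable_mu_density.
Qed.

(** Take k with 4^k <= u < 4^(k+1). Since ln u = 4 ln (u^(1/4)) <= 4 u^(1/4), the square is at most
    16 u^(1/2) <= 16 * 2^(k+1). *)
Lemma ln_sqr_le_pow (u : R) : 1 <= u ->
  exists k : nat, 4 ^+ k <= u /\ ln u ^+ 2 <= 32 * 2 ^+ k.
Proof.
move=> u1; have u0 : 0 < u := lt_le_trans ltr01 u1.
have [k ku uk] : exists2 k : nat, 4 ^+ k <= u & u < 4 ^+ k.+1.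
  have exP : exists n : nat, u < 4 ^+ n.
    exists (Num.bound u); apply: (lt_le_trans (archi_boundP (ltW u0))).
    by rewrite -natrX ler_nat ltnW// ltn_expl.
  case: (ex_minnP exP) => -[|k] uk kmin; first by move: uk; rewrite expr0 ltNge u1.
  by exists k => //; rewrite leNgt; apply/negP => /kmin; rewrite ltnn.
exists k; split => //.
pose v := Num.sqrt u; pose x := Num.sqrt v.
have v0 : 0 < v by rewrite sqrtr_gt0.
have x0 : 0 < x by rewrite sqrtr_gt0.
have uE : u = x ^+ 4 by rewrite (exprM _ 2 2) !sqr_sqrtr// ltW.
have v2 : v <= 2 ^+ k.+1.
  rewrite -(@ler_pXn2r _ 2)// ?nnegrE ?exprn_ge0 ?(ltW v0)// sqr_sqrtr ?(ltW u0)//.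
  by rewrite exprAC (_ : 2 ^+ 2 = 4) ?ltW// -natrX.
have l0 : 0 <= ln u by exact: ln_ge0.
have lx : ln u <= 4 * x.
  by rewrite uE lnXn// -(mulr_natl (ln x)) ler_wpM2l// ltW// ln_sublinear.
apply: (@le_trans _ _ ((4 * x) ^+ 2)); first by rewrite lerXn2r ?nnegrE// mulr_ge0// ltW.
rewrite exprMn sqr_sqrtr ?(ltW v0)//; move: v2; rewrite exprS.
by set p := 2 ^+ k => v2; rewrite -natrX; lra.
Qed.

(** On the disk |1 - conj z w| <= 2, so [z, w] >= |Re z - Re w| / 2, and [ln_sqr_le_pow] applies to
    u = 2 / |Re z - Re w|. *)
Lemma ln_inv_dist_sqr_le z w : disk z -> disk w -> z.1 != w.1 ->
  exists k : nat, `|z.1 - w.1| <= 2 / 4 ^+ k /\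
    (ln (pseudo_hyp_dist z w)^-1) ^+ 2 <= 32 * 2 ^+ k.
Proof.
move=> zD wD zw; have D0 := den_gt0 zD wD.
have /andP[z0 z1] := disk_sqn zD; have /andP[w0 w1] := disk_sqn wD.
set X := `|z.1 - w.1|.
have X0 : 0 < X by rewrite normr_gt0 subr_eq0.
have X2 : X ^+ 2 = (z.1 - w.1) ^+ 2 by rewrite real_normK ?num_real.
have D4 : den z w <= 4.
  rewrite den_sqn; move: z0 z1 w0 w1; rewrite /sqn.
  move: (z.1) (z.2) (w.1) (w.2) => a b c e.
  have := sqr_ge0 (a + c); have := sqr_ge0 (b + e).
  nra.
have XD : X / 2 <= pseudo_hyp_dist z w.
  rewrite pseudo_hyp_distE//.
  rewrite -(@ler_pXn2r _ 2)// ?nnegrE ?divr_ge0 ?sqrtr_ge0 ?(ltW X0)//.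
  have d2 : 0 <= dist2 z w by rewrite addr_ge0 ?sqr_ge0.
  rewrite sqr_sqrtr ?divr_ge0// ?(ltW D0)// exprMn X2.
  rewrite ler_pM ?sqr_ge0 ?exprn_ge0 ?invr_ge0//.
    by rewrite /dist2 lerDl sqr_ge0.
  by rewrite exprVn lef_pV2 ?posrE// -natrX.
have d1 : pseudo_hyp_dist z w <= 1.
  rewrite pseudo_hyp_distE// szego_ratioE// -[leRHS]sqrtr1 ler_sqrt//.
  by rewrite gerBl ltW// szego_ratio_gt0.
have d0 : 0 < pseudo_hyp_dist z w by apply: lt_le_trans XD; rewrite divr_gt0.
have u1 : 1 <= 2 / X.
  by rewrite -(invf_div) invf_ge1 ?divr_gt0//; exact: le_trans d1.
have [k [ku lu]] := ln_sqr_le_pow u1.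
exists k; split.
  rewrite ler_pdivlMr ?exprn_gt0// mulrC -ler_pdivlMr//.
apply: le_trans lu; rewrite lerXn2r ?nnegrE ?ln_ge0//.
  by rewrite invf_ge1.
rewrite ler_ln ?posrE ?invr_gt0 ?divr_gt0// -(invf_div X 2).
by rewrite lef_pV2 ?posrE ?divr_gt0.
Qed.

(** * Estimates on a measurable set where |z|^2 <= r < 1 *)

Section relatively_compact.
Variables (Omega : set (plane R)) (r : R).
Hypotheses (mO : measurable Omega) (OD : Omega `<=` disk) (r1 : r < 1).
Hypothesis Or : forall z, Omega z -> sqn z <= r.

Let c : R := pi^-1 / (1 - r) ^+ 2.

Let c_ge0 : 0 <= c.
Proof. by rewrite divr_ge0 ?invr_ge0 ?pi_ge0 ?sqr_ge0. Qed.

(** On [Omega] the density is at most [c], and the strip meets the disk inside a rectangle of width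
    2e and height 2. *)
Lemma hyp_measure_strip (x e : R) : 0 <= e ->
  (mu (Omega `&` [set w | (`|x - w.1| <= e)%R]) <= (c * (4 * e))%:E)%E.
Proof.
move=> e0; set A := Omega `&` _.
have mI (a b : R) : measurable `[a, b]%classic by exact: measurable_itv.
pose S : set (plane R) := `[x - e, x + e]%classic `*` `[-1, 1]%classic.
have mS : measurable S by exact: measurableX.
have mA : measurable A.
  by apply: measurableI => //; exact: measurable_strip.
have AS : A `<=` S.
  move=> w [/OD/disk_sqn/andP[_]]; rewrite /sqn /= ler_distlC => w1 wx.
  split; rewrite /= in_itv//=; apply/andP; split; nra.
apply: (@le_trans _ _ (c%:E * area A)%E).
  apply: hyp_measure_le => // w [Ow _].
  rewrite /mu_density patchE ifT; last by apply/mem_set; exact: OD.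
  rewrite cmod_sqr -/(sqn w); have := Or Ow => wr.
  rewrite /c ler_wpM2l ?invr_ge0 ?pi_ge0// lef_pV2 ?posrE ?exprn_gt0 ?subr_gt0//.
    by rewrite lerXn2r ?nnegrE ?subr_ge0 ?lerB// ?(ltW r1)// (le_trans wr)// ltW.
  exact: le_lt_trans r1.
rewrite (EFinM c); apply: lee_wpmul2l; first by rewrite lee_fin.
apply: (@le_trans _ _ (area S)); first by apply: le_measure; rewrite ?inE.
rewrite areaX// !lebesgue_measure_itv /= !lte_fin.
rewrite (_ : -1 < 1 :> R = true)%R; last by apply/idP; lra.
rewrite (_ : 1 - -1 = 2)%E; last by rewrite -EFinN -EFinB; congr EFin; lra.
case: ifPn => h; last by rewrite mul0e lee_fin mulr_ge0.
by rewrite -EFinB -EFinM lee_fin; lra.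
Qed.

Lemma hyp_measure_fin : (mu Omega < +oo)%E.
Proof.
rewrite (_ : Omega = Omega `&` [set w | (`|0 - w.1| <= 1)%R]).
  exact: le_lt_trans (hyp_measure_strip _ _) (ltry _).
apply/seteqP; split => [w Ow|w []//]; split => //=.
have := disk_sqn (OD Ow); rewrite /sqn sub0r normrN ler_norml => /andP[_ h].
by apply/andP; split; nra.
Qed.

Lemma green_sqr_bound : exists B : R, forall z, Omega z ->
  measurable_fun Omega (fun w => ln (pseudo_hyp_dist z w)^-1) ->
  (\int[mu]_(w in Omega) ((ln (pseudo_hyp_dist z w)^-1) ^+ 2)%:E <= B%:E)%E.
Proof.
(* Layer k contributes at most 32 * 2^k * c * 4 * (2 / 4^k) = 512 c / 2^(k+1), and these bounds sum
   to 512 c. *)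
exists (512 * c) => z Oz mK.
pose A k : set (plane R) := Omega `&` [set w | `|z.1 - w.1| <= 2 / 4 ^+ k].
have mA k : measurable (A k).
  by apply: measurableI => //; exact: measurable_strip.
(* The squared kernel is O(t^(-1/2)) in t = |Re z - Re w|, which is dominated by
   the sum over k of 32 * 2^k on the strip t <= 2 / 4^k; as the strip has measure
   O(4^-k), layer k contributes O(2^-k) to the integral. *)
pose g k w : \bar R := ((32 * 2 ^+ k) * \1_(A k) w)%:E.
have g0 k w : (0 <= g k w)%E.
  by rewrite lee_fin mulr_ge0// mulr_ge0// exprn_ge0.
have mg k : measurable_fun Omega (g k).
  by apply/measurable_EFinP; apply: measurable_funM.
apply: (@le_trans _ _ (\int[mu]_(w in Omega) (\sum_(k <oo) g k w))%E).
  apply: ae_ge0_le_integral => //.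
  - by move=> w _; rewrite lee_fin sqr_ge0.
  - by apply/measurable_EFinP; exact: measurable_funX.
  - by move=> w _; apply: nneseries_ge0 => k _ _; exact: g0.
  - by apply: ge0_emeasurable_sum => k //.
  (* The layers dominate the kernel only where Re w differs from Re z; the exceptional vertical line
     is null. *)
  - exists [set w : plane R | w.1 = z.1]; split.
    + exact: measurable_vertical_line.
    + exact: mu_vertical_line.
    + move=> w; apply: contra_notP => /= /eqP wz Ow.
      have [|k [zk lk]] := ln_inv_dist_sqr_le (OD Oz) (OD Ow); first by rewrite eq_sym.
      apply: le_trans (@nneseries_lim_ge R (g ^~ w) xpredT 0 k.+1 _); last by move=> *; exact: g0.
      rewrite big_mkord big_ord_recr /=.
      apply: (@le_trans _ _ (g k w)); last by rewrite leeDr// sume_ge0.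
      by rewrite /g lee_fin indicE mem_set ?mulr1.
rewrite integral_nneseries//.
have c512 : 0 <= 512 * c by exact: mulr_ge0 (ler0n R 512) c_ge0.
apply: (le_trans _ (epsilon_trick0 xpredT c512)).
apply: lee_nneseries => [k _ _|k _]; first exact: integral_ge0.
rewrite /g; under eq_integral do rewrite EFinM.
rewrite ge0_integralZl//; last by exact/measurable_EFinP.
rewrite integral_indic// setIidl; last by move=> w [].
apply: (@le_trans _ _ ((32 * 2 ^+ k)%:E * (c * (4 * (2 / 4 ^+ k)))%:E)%E).
  apply: lee_wpmul2l; first by rewrite lee_fin mulr_ge0 ?exprn_ge0.
  by apply: hyp_measure_strip; rewrite divr_ge0// exprn_ge0.
rewrite -EFinM lee_fin natrX exprS (_ : 4 ^+ k = 2 ^+ k * 2 ^+ k :> R); last first.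
  by rewrite -exprMn; congr (_ ^+ _); rewrite -natrM.
have : 2 ^+ k != 0 :> R by rewrite expf_neq0.
by set p := 2 ^+ k => p0; rewrite le_eqVlt; apply/orP; left; apply/eqP; field.
Qed.

End relatively_compact.
End hyperbolic_measure.

(** * Passage to the limit *)

Section relatively_compact.
Context {R : realType}.
Implicit Types (z w : plane R) (Omega : set (plane R)) (f : plane R -> R).

(** A bound uniform in z: with x = Re (conj z w), x <= (1 + x^2) / 2 <= (1 + |w|^2) / 2, hence 1 - x
    >= (1 - |w|^2) / 2. *)
Lemma den_ge z w : disk z -> disk w -> ((1 - sqn w) / 2) ^+ 2 <= den z w.
Proof.
move=> zD wD.
have /andP[z0 z1] := disk_sqn zD; have /andP[w0 w1] := disk_sqn wD.
pose x := z.1 * w.1 + z.2 * w.2.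
have xw : x ^+ 2 <= sqn w.
  have : x ^+ 2 + (z.1 * w.2 - z.2 * w.1) ^+ 2 = sqn z * sqn w.
    by rewrite /x /sqn; ring.
  have := sqr_ge0 (z.1 * w.2 - z.2 * w.1); nra.
apply: (@le_trans _ _ ((1 - x) ^+ 2)); last by rewrite /den lerDl sqr_ge0.
rewrite lerXn2r ?nnegrE; nra.
Qed.

(** Fix w in [Omega] and put d = [z, w], E = e^M. The distance bound reads (1 + d) / (1 - d) <= E,
    so q = 1 - d^2 >= 1 / E; the lower bound [den_ge] then keeps 1 - |z|^2 away from 0. *)
Lemma hyp_bounded_sqn Omega : Omega `<=` disk -> hyp_bounded Omega ->
  exists2 r : R, r < 1 & forall z, Omega z -> sqn z <= r.
Proof.
move=> OD [M HM].
have [->|/set0P[w Ow]] := eqVneq Omega set0; first by exists 0.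
have wD := OD _ Ow; have /andP[w0 w1] := disk_sqn wD.
pose E := expR M; have E0 : 0 < E by exact: expR_gt0.
(* From q den = (1 - |z|^2) (1 - |w|^2), q >= 1 / E and den >= (1 - |w|^2)^2 / 4. *)
exists (1 - (1 - sqn w) / (4 * E)).
  by rewrite gtrBl divr_gt0 ?subr_gt0 ?mulr_gt0.
move=> z Oz; have zD := OD _ Oz; have /andP[z0 z1] := disk_sqn zD.
have q0 := szego_ratio_gt0 zD wD.
pose d := pseudo_hyp_dist z w.
have qge0 : 0 <= 1 - szego_ratio z w.
  rewrite -szego_ratioE// divr_ge0// ?(ltW (den_gt0 zD wD))//.
  by rewrite addr_ge0 ?sqr_ge0.
have dE : d ^+ 2 = 1 - szego_ratio z w.
  by rewrite /d pseudo_hyp_distE// szego_ratioE// sqr_sqrtr.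
have d0 : 0 <= d by rewrite /d pseudo_hyp_distE// sqrtr_ge0.
have d1 : d < 1 by nra.
have hE : (1 + d) <= E * (1 - d).
  rewrite -ler_pdivrMr ?subr_gt0//.
  have p0 : 0 < (1 + d) / (1 - d) by rewrite divr_gt0 ?subr_gt0// ltr_wpDr.
  rewrite -(lnK p0) ler_expR.
  by have := HM z w Oz Ow; rewrite /hyp_dist /artanh -/d mulrA mulfV ?mul1r.
have hq : 1 <= E * szego_ratio z w.
  have -> : szego_ratio z w = (1 - d) * (1 + d) by move: dE; lra.
  nra.
have D0 := den_gt0 zD wD; have Dge := den_ge zD wD.
have hD : szego_ratio z w * den z w = (1 - sqn z) * (1 - sqn w).
  by rewrite /szego_ratio divfK// gt_eqF.
rewrite lerBrDr -lerBrDl ler_pdivrMr ?mulr_gt0//.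
move: hq hD Dge q0; set q := szego_ratio z w; set D := den z w.
move: w0 w1 z0 z1 E0; set m := sqn w; set n := sqn z.
move=> w0 w1 z0 z1 E0 hq hD Dge q0.
have h1 : ((1 - m) / 2) ^+ 2 <= E * ((1 - n) * (1 - m)).
  by rewrite -hD mulrA (le_trans Dge)// ler_peMl// ltW.
have m1 : 0 < 1 - m by lra.
rewrite -(ler_pM2r m1); nra.
Qed.

Definition szego_approx N z w : R :=
  (1 - sqn z) * (1 - sqn w) * geom_kernel N z w.

Lemma finite_rank_log_sum M N :
  finite_rank disk_bounded (fun z w => 2^-1 * log_sum M (szego_approx N z w)).
Proof.
apply: finite_rankZ => //; apply: (@finite_rank_sum _ _ _ _ M
  (fun k z w => szego_approx N z w ^+ k.+1 / k.+1%:R)) => k.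
rewrite (_ : (fun _ => _) =
    fun z w => k.+1%:R^-1 * szego_approx N z w ^+ k.+1); last first.
  by apply/funext => z; apply/funext => w; rewrite mulrC.
apply: finite_rankZ; first by rewrite invr_ge0.
apply: finite_rankX; [exact: disk_boundedM | exact: disk_bounded_cst |].
apply: finite_rankM; [exact: disk_boundedM | | exact: finite_rank_geom].
apply: (@finite_rank1 _ _ _ _ (fun z => 1 - sqn z)).
apply: disk_boundedD; first exact: disk_bounded_cst.
apply: disk_boundedN; apply: disk_boundedD; rewrite /=.
  by apply: disk_boundedM; exact: disk_bounded_fst.
by apply: disk_boundedM; exact: disk_bounded_snd.
Qed.

Lemma log_sum_le M (x y : R) : 0 <= x <= y -> 0 <= log_sum M x <= log_sum M y.
Proof.
move=> /andP[x0 xy]; apply/andP; split.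
  by apply: sumr_ge0 => k _; rewrite divr_ge0// exprn_ge0.
apply: ler_sum => k _; rewrite ler_wpM2r// lerXn2r// nnegrE//.
exact: le_trans xy.
Qed.

Lemma continuous_log_sum M : continuous (@log_sum R M).
Proof.
move=> x; apply/differentiable_continuous/derivable1_diffP.
by have [] := is_derive_log_sum M x.
Qed.

Lemma szego_approx_cvg z w : disk z -> disk w ->
  szego_approx N z w @[N --> \oo] --> szego_ratio z w.
Proof. by move=> zD wD; apply: cvgMr; exact: geom_kernel_cvg. Qed.

Lemma szego_approx_le N z w : disk z -> disk w ->
  0 <= szego_approx N z w <= 4 / den z w.
Proof.
move=> zD wD; have /andP[g0 g4] := geom_kernel_le N zD wD.
have /andP[z0 z1] := disk_sqn zD; have /andP[w0 w1] := disk_sqn wD.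
have p0 : 0 <= (1 - sqn z) * (1 - sqn w) by rewrite mulr_ge0// subr_ge0 ltW.
have p1 : (1 - sqn z) * (1 - sqn w) <= 1.
  by rewrite mulr_ile1 ?subr_ge0 ?gerBl// ltW.
rewrite mulr_ge0//=; apply: le_trans g4.
by rewrite ler_piMl.
Qed.

(** * The limit N -> oo in the geometric sum, then M -> oo in the logarithmic series *)

Section kernel_limits.
Variables (Omega : set (plane R)) (r : R) (f : plane R -> R).
Hypotheses (mO : measurable Omega) (OD : Omega `<=` disk) (r1 : r < 1).
Hypothesis Or : forall z, Omega z -> sqn z <= r.
Hypothesis f2 : L2 Omega f.

Let green z w : R := ln (pseudo_hyp_dist z w)^-1.

Lemma L2_integrable : mu.-integrable Omega (EFin \o f).
Proof.
have [mf if2] := f2.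
have i1 : mu.-integrable Omega (EFin \o (fun=> 1)).
  apply: measurable_bounded_integrable => //.
    exact: hyp_measure_fin mO OD r1 Or.
  exists 1; split; first exact: num_real.
  by move=> x x1 z _; rewrite /= normr1 ltW.
apply: le_integrable (integrableD mO i1 if2) => //; first exact/measurable_EFinP.
move=> z _ /=; rewrite lee_fin [leRHS]ger0_norm ?addr_ge0 ?sqr_ge0//.
have := real_normK (num_real (f z)); have := normr_ge0 (f z).
by move=> h0 <-; nra.
Qed.

Lemma disk_bounded_Omega phi : disk_bounded phi ->
  measurable_fun Omega phi /\ [bounded phi x | x in Omega].
Proof.
move=> [mphi [M HM]]; split; first exact: measurable_funTS.
exists M; split; first exact: num_real.
by move=> x Mx z Oz /=; rewrite (le_trans (HM z (OD Oz)))// ltW.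
Qed.

Lemma measurable_log_sum M z : Omega z ->
  measurable_fun Omega (fun w => 2^-1 * log_sum M (szego_ratio z w)).
Proof.
move=> Oz; apply: (@measurable_fun_cvg _ _ _ Omega
  (fun N w => 2^-1 * log_sum M (szego_approx N z w))) => [N|w Ow].
  apply: finite_rank_measurable (finite_rank_log_sum M N) => phi.
  by move=> /disk_bounded_Omega[].
apply: cvgMr; apply: continuous_cvg; first exact: continuous_log_sum.
by apply: szego_approx_cvg; exact: OD.
Qed.

(** First limit, in N. As M is fixed, [log_sum M] is a polynomial, so a uniform bound on its
    argument suffices for domination, even one above 1. *)
Lemma log_sum_kernel_pos M :
  kernel_pos mu Omega f (fun z w => 2^-1 * log_sum M (szego_ratio z w)).
Proof.
(* [b] bounds every [szego_approx] on [Omega], by [szego_approx_le] and [den_ge]. *)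
pose b : R := 4 / ((1 - r) / 2) ^+ 2.
pose C : R := 2^-1 * log_sum M b.
have r0 : 0 < (1 - r) / 2 by rewrite divr_gt0// subr_gt0.
have b0 : 0 <= b by rewrite divr_ge0// sqr_ge0.
have C0 : 0 <= C.
  by have /andP[? _] := @log_sum_le M b b (introT andP (conj b0 (lexx _))); rewrite mulr_ge0.
have iF := L2_integrable.
have iCf : mu.-integrable Omega (EFin \o (fun w => C * `|f w|)).
  rewrite (_ : _ \o _ = fun z => C%:E * (`|f z|)%:E)%E//.
  by apply: integrableZl => //; exact: integrable_norm.
have [] // := @kernel_pos_lim _ _ _ mu Omega f
  (fun N z w => 2^-1 * log_sum M (szego_approx N z w))
  (fun z w => 2^-1 * log_sum M (szego_ratio z w))
  (fun _ w => C * `|f w|) (\int[mu]_(w in Omega) (C * `|f w|)) mO iF.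
- move=> N; apply: (@finite_rank_pos _ _ _ _ _ _ disk_bounded) => //.
    exact: disk_bounded_Omega.
  exact: finite_rank_log_sum.
- move=> N z Oz; apply: finite_rank_measurable (finite_rank_log_sum M N) => phi.
  by move=> /disk_bounded_Omega[].
- exact: measurable_log_sum.
- move=> z Oz; apply: nearW => w Ow.
  apply: cvgMr; apply: continuous_cvg; first exact: continuous_log_sum.
  by apply: szego_approx_cvg; exact: OD.
- by move=> z w _ _; rewrite mulr_ge0.
- move=> z Oz; apply: nearW => w N Ow.
  rewrite normrM ler_wpM2r//.
  have /andP[s0 s4] := szego_approx_le N (OD Oz) (OD Ow).
  have sb : 0 <= szego_approx N z w <= b.
    rewrite s0; apply: (le_trans s4); rewrite /b ler_wpM2l// lef_pV2 ?posrE.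
    + apply: le_trans (den_ge (OD Oz) (OD Ow)).
      have wr := Or Ow; rewrite lerXn2r ?nnegrE ?(ltW r0)//; first by lra.
      by lra.
    + exact: den_gt0 (OD Oz) (OD Ow).
    + by rewrite exprn_gt0.
  have /andP[l0 lb] := log_sum_le M sb.
  by rewrite ger0_norm ?mulr_ge0// /C ler_wpM2l.
Qed.

Lemma szego_ratio_lt1 z w : disk z -> disk w -> z <> w -> szego_ratio z w < 1.
Proof.
move=> zD wD zw; rewrite -subr_gt0 -szego_ratioE// divr_gt0 ?den_gt0//.
exact: dist2_gt0.
Qed.

Lemma log_sum_green_cvg z w : disk z -> disk w -> z <> w ->
  2^-1 * log_sum M (szego_ratio z w) @[M --> \oo] --> green z w.
Proof.
move=> zD wD zw; rewrite /green ln_pseudo_hyp_distE//.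
apply: cvgMr; apply: log_sum_cvg.
by rewrite (ltW (szego_ratio_gt0 zD wD)) szego_ratio_lt1.
Qed.

(* The indicator removes the diagonal, where the partial sums diverge but the
   kernel has the junk value ln (0^-1) = 0. *)
Lemma measurable_green z : Omega z -> measurable_fun Omega (green z).
Proof.
move=> Oz; apply: (@measurable_fun_cvg _ _ _ Omega
  (fun M w => 2^-1 * log_sum M (szego_ratio z w) * \1_(~` [set z]) w)).
  move=> M; apply: measurable_funM; first exact: measurable_log_sum.
  apply: measurable_indic; apply: measurableC.
  rewrite (_ : [set z] = [set z.1] `*` [set z.2]); first exact: measurableX.
  apply/seteqP; split => [w ->//|[a b] [/= -> ->]].
  by rewrite -surjective_pairing.
move=> w Ow; have zD := OD Oz; have wD := OD Ow.
have [->|zw] := eqVneq w z.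
  have -> : green z z = 0.
    rewrite /green pseudo_hyp_distE// /dist2 !subrr expr0n /= addr0 mul0r sqrtr0.
    by rewrite invr0 ln0.
  have e0 : \1_(~` [set z]) z = 0 :> R by rewrite indicE memNset//; apply.
  by under eq_fun do rewrite e0 mulr0; exact: cvg_cst.
have e1 : \1_(~` [set z]) w = 1 :> R by rewrite indicE mem_set//; exact/eqP.
under eq_fun do rewrite e1 mulr1.
by apply: log_sum_green_cvg => // zwE; move: zw; rewrite zwE eqxx.
Qed.

Lemma green_kernel_pos : kernel_pos mu Omega f green /\
  exists B, forall z, Omega z -> `|kernel_op mu Omega f green z| <= B.
Proof.
have [mf if2] := f2; have iF := L2_integrable.
have [B HB] := green_sqr_bound mO OD r1 Or.
have mg2 z : Omega z -> measurable_fun Omega (EFin \o (fun w => green z w ^+ 2)).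
  by move=> Oz; apply/measurable_EFinP; apply: measurable_funX; exact: measurable_green.
have ig2 z : Omega z -> mu.-integrable Omega (EFin \o (fun w => green z w ^+ 2)).
  move=> Oz; apply/integrableP; split; first exact: mg2.
  apply: le_lt_trans (ltry B).
  under eq_integral do rewrite /= ger0_norm ?sqr_ge0//.
  by apply: HB => //; exact: measurable_green.
pose S := \int[mu]_(w in Omega) (f w ^+ 2).
pose h z w := 2^-1 * (green z w ^+ 2 + f w ^+ 2).
have iD z : Omega z -> mu.-integrable Omega (EFin \o (fun w => green z w ^+ 2 + f w ^+ 2)).
  move=> Oz; rewrite (_ : _ \o _ = (EFin \o (fun w => green z w ^+ 2)%R)
    \+ (EFin \o (fun w => f w ^+ 2)%R))%E//; exact: integrableD (ig2 z Oz) if2.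
have zline z : mu.-negligible [set w | w.1 = z.1].
  exists [set w : plane R | w.1 = z.1]; split => //.
    exact: measurable_vertical_line.
  exact: mu_vertical_line.
(* The diagonal, where the partial sums do not converge to [green], lies in a null vertical line. *)
have ae_ne z : {ae mu, forall w, z <> w}.
  apply: (negligibleS _ (zline z)) => w /=.
  by move=> /contrapT ->.
have [] := @kernel_pos_lim _ _ _ mu Omega f
  (fun M z w => 2^-1 * log_sum M (szego_ratio z w)) green h
  (2^-1 * (B + S)) mO iF.
- exact: log_sum_kernel_pos.
- by move=> M z; exact: measurable_log_sum.
- exact: measurable_green.
- move=> z Oz; apply: filterS (ae_ne z) => w zw Ow.
  by apply: log_sum_green_cvg => //; exact: OD.
- move=> z Oz; rewrite (_ : _ \o _ = fun w => (2^-1)%:E * (green z w ^+ 2 + f w ^+ 2)%:E)%E//.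
  by apply: integrableZl => //; exact: iD.
- by move=> z w _ _; rewrite mulr_ge0// addr_ge0 ?sqr_ge0.
- move=> z Oz; rewrite RintegralZl//; last exact: iD.
  rewrite ler_wpM2l// RintegralD//; last exact: ig2.
  rewrite lerD2r -lee_fin /Rintegral fineK; last exact: integrable_fin_num (ig2 z Oz).
  by apply: HB => //; exact: measurable_green.
- move=> z Oz; apply: filterS (ae_ne z) => w zw M Ow.
  have zD := OD Oz; have wD := OD Ow.
  have q0 := ltW (szego_ratio_gt0 zD wD); have q1 := szego_ratio_lt1 zD wD zw.
  have q01 : 0 <= szego_ratio z w < 1 by rewrite q0.
  have /andP[l1 _] := log_sum_bounds M q01.
  have /andP[l0 _] := log_sum_le M (introT andP (conj q0 (lexx (szego_ratio z w)))).
  rewrite normrM ger0_norm ?mulr_ge0//.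
  (* The series has nonnegative terms, so its partial sums stay below [green]; the product is then
     bounded by 2ab <= a^2 + b^2. *)
  apply: (@le_trans _ _ (green z w * `|f w|)).
    rewrite ler_wpM2r// /green ln_pseudo_hyp_distE// ler_wpM2l//.
    by rewrite -subr_ge0.
  rewrite /h -(real_normK (num_real (f w))).
  have := sqr_ge0 (green z w - `|f w|); nra.
- by move=> kp kB; split => //; exists (2^-1 * (B + S)).
Qed.

End kernel_limits.
End relatively_compact.

(** * Positivity of the logarithmic potential operator *)

Unset Implicit Arguments.

Theorem theorem1p5 (R : realType) (Omega : set (plane R))
  (Omega_open : open Omega) (Omega_disk : Omega `<=` disk)
  (Omega_bounded : hyp_bounded Omega) :
  positive_operator Omega (Lh Omega).
Proof.
move=> f f2; have mO := open_measurable_plane Omega_open.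
have [r r1 Or] := hyp_bounded_sqn Omega_disk Omega_bounded.
have [[mk pk] [B kB]] := green_kernel_pos mO Omega_disk r1 Or f2.
have iF := L2_integrable mO Omega_disk r1 Or f2.
set k := kernel_op _ _ _ _ in mk pk kB.
have LhE : Lh Omega f = fun z => 2^-1 * k z by [].
have bk : [bounded k z | z in Omega].
  exists B; split; first exact: num_real.
  by move=> x Bx z Oz /=; rewrite (le_trans (kB z Oz))// ltW.
rewrite LhE; split.
(* The image is bounded on a set of finite measure, hence square integrable. *)
- split; first exact: measurable_funM.
  apply: measurable_bounded_integrable => //.
  + exact: hyp_measure_fin mO Omega_disk r1 Or.
  + by apply: measurable_funX; exact: measurable_funM.
  + exists ((2^-1 * B) ^+ 2); split; first exact: num_real.
    move=> x Bx z Oz /=; apply: ltW; apply: le_lt_trans Bx.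
    rewrite normrX normrM lerXn2r ?nnegrE ?mulr_ge0//.
      by rewrite (le_trans _ (kB z Oz)).
    by rewrite ger0_norm// ler_wpM2l// kB.
- rewrite /inner; under eq_Rintegral do rewrite -mulrA.
  rewrite RintegralZl ?mulr_ge0//.
  rewrite (_ : _ \o _ = ((EFin \o k) \* (EFin \o f))%E).
    exact: integrableMr.
  by apply/funext => z /=; rewrite EFinM.
Qed.
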